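(* An aromatic Runge–Kutta method cannot be volume-preserving. That is, if $a:\widetilde\Omega_1\to\mathbb R$ is the coefficient map of a consistent aromatic Runge–Kutta method and $b$ is the coefficient map of its modified vector field ($b\star e=a$), then $d_HB(b)\ne0$.
   Context: Aromatic forests (without covertices). Let $V$ be a finite nonempty set of nodes and $E\subset V\times V$ a set of edges; an edge $(v,w)$ goes from $v$ to $w$ and then $v$ is a predecessor of $w$. Each node is the source of at most one edge; nodes with no outgoing edge are roots, numbered $1,\dots,n$. Such graphs up to isomorphism preserving the numbering of roots are aromatic forests; $\mathcal F_n$ (resp. $\mathcal F_n^N$) is the set of those with $n$ roots (resp. and $N$ nodes). $\mathcal T\subset\mathcal F_1$ is the set of connected elements (Butcher trees, no aromas). $\bullet\in\mathcal F_1$ is the one-node tree. $\sigma(\gamma)$ is the number of automorphisms of $\gamma$. For $n\in\{0,1\}$, $\Omega_n^N=\operatorname{Span}_{\mathbb R}(\mathcal F_n^N)$, and $\widetilde\Omega_n^N$ is its quotient by the span of forests with at least one 1-loop (edge $(v,v)$); $\widetilde\Omega_n=\bigoplus_N\widetilde\Omega_n^N$. $\widetilde{\mathcal F}_1\subset\mathcal F_1$ is the set of forests without 1-loops, a basis of $\widetilde\Omega_1$. For $\gamma\in\mathcal F_1$ with root $r$, $d_H\gamma$ is the sum over all nodes $u$ of $\gamma$ with the edge $(r,u)$ added; it induces $d_H:\widetilde\Omega_1^N\to\widetilde\Omega_0^N$, extended termwise to formal series. B-series (setting $\operatorname{div}f=0$, so forests with 1-loops are set to $0$). For a linear map $a:\widetilde\Omega_1\to\mathbb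 R$, $B(a)=\sum_{\tau\in\widetilde{\mathcal F}_1}\frac{a(\tau)}{\sigma(\tau)}\tau$, a formal series. For $\tau_1,\tau_2\in\mathcal F_1$, $\tau_1\curvearrowright\tau_2$ is the sum over all nodes $u$ of $\tau_2$ of the aromatic tree obtained from the disjoint union of $\tau_1,\tau_2$ by adding an edge from the root of $\tau_1$ to $u$; extend bilinearly to formal series. For a formal series $X$ set $X^{[1]}=X$, $X^{[k+1]}=X\curvearrowright X^{[k]}$. The map $b\star e$ (substitution of $B(b)$ into the exact flow, whose coefficient map is $e$) is defined by $B(b\star e)=\sum_{k\ge1}\frac1{k!}B(b)^{[k]}$. An aromatic B-series method is a one-step integrator $\Phi(y,h)$ whose formal Taylor expansion is the aromatic B-series $B(a)$ (with trees replaced by elementary differentials of $hf$, added to $y$); it is consistent if $a(\bullet)=1$. Its modified vector field has B-series $B(b)$ with $b$ the unique map satisfying $b\star e=a$. It is volume-preserving if $d_HB(b)=0$ in $\prod_N\widetilde\Omega_0^N$. It is an aromatic Runge–Kutta method if it reduces to a standard Runge–Kutta method when all aromatic trees containing aromas are sent to zero (i.e. for $f$ whose elementary differentials vanish on $\mathcal F_1\setminus\mathcal T$); equivalently for some $s\ge1$, $A=(a_{ij})\in\mathbb R^{s\times s}$, $w\in\mathbb R^s$, the restriction of $a$ to $\mathcal T$ is given by the elementary weights of $y_1=y_0+h\sum_iw_if(Y_i)$, $Y_i=y_0+h\sum_ja_{ij}f(Y_j)$, namely $a(\tau)=\sum\, w_{i_r}\prod_{(v,u)\in E}a_{i_ui_v}$,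 the sum being over all assignments $i:V\to\{1,\dots,s\}$, with $r$ the root of $\tau$. *)

(* Defs.v *)
From HB Require Import structures.
From mathcomp Require Import all_boot all_order all_algebra.
From mathcomp Require Import reals.

Set Implicit Arguments.
Unset Strict Implicit.
Unset Printing Implicit Defensive.

Import GRing.Theory Num.Theory.
Local Open Scope ring_scope.
Local Open Scope quotient_scope.

(* [g v = Some w] iff (v, w) is an edge; [g v = None] iff v is a root. *)
Definition graph (V : finType) := {ffun V -> option V}.
HB.instance Definition _ (V : finType) := Finite.on (graph V).

Section Graph.
Variable V : finType.
Implicit Type g : graph V.

Definition edge g : rel V := fun v w => g v == Some w.
Definition is_root g : pred V := fun v => g v == None.
Definition has_loop g := [exists v, edge g v v].
Definition connected g :=
  [forall v, forall w, connect (fun x y => edge g x y || edge g y x) v w].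

Definition is_forest n g := (0 < #|V|)%N && (#|is_root g| == n).

(* For a graph with a single root r, this adds the edge (r, u). *)
Definition add_edge g (u : V) : graph V :=
  [ffun v => if g v is Some w then Some w else Some u].

End Graph.

(* For [g1] with a single root r, this is the disjoint union of [g1] and [g2]
   with the additional edge (r, u). *)
Definition graft_at (V1 V2 : finType) (g1 : graph V1) (g2 : graph V2) (u : V2)
    : graph (V1 + V2)%type :=
  [ffun v => match v with
             | inl x => if g1 x is Some y then Some (inl y) else Some (inr u)
             | inr x => omap inr (g2 x)
             end].

Definition is_iso (V W : finType) (g : graph V) (h : graph W)
    (f : {ffun V -> W}) :=
  [&& injectiveb f, #|V| == #|W| & [forall v, h (f v) == omap f (g v)]].

Definition iso (V W : finType) (g : graph V) (h : graph W) :=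
  [exists f, is_iso g h f].

Definition nb_aut (V : finType) (g : graph V) := #|[set f | is_iso g g f]|.

Lemma is_isoP (V W : finType) (g : graph V) (h : graph W) (f : {ffun V -> W}) :
  reflect (bijective f /\ forall v, h (f v) = omap f (g v)) (is_iso g h f).
Proof.
apply: (iffP and3P) => [[/injectiveP fI /eqP c /forallP E]|[fB E]].
  by split; [apply: inj_card_bij; rewrite ?c | move=> v; apply/eqP].
split; first by apply/injectiveP; apply: bij_inj.
  by apply/eqP; apply: bij_eq_card fB.
by apply/forallP => v; apply/eqP.
Qed.

Lemma isoP (V W : finType) (g : graph V) (h : graph W) :
  reflect (exists2 f : V -> W, bijective f & forall v, h (f v) = omap f (g v))
          (iso g h).
Proof.
apply: (iffP existsP) => [[f /is_isoP [fB E]]|[f fB E]]; first by exists f.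
exists (finfun f); apply/is_isoP; split.
  by apply: eq_bij fB _ _ => x; rewrite ffunE.
by move=> v; rewrite ffunE E; case: (g v) => //= w; rewrite ffunE.
Qed.

Lemma iso_refl (V : finType) (g : graph V) : iso g g.
Proof. by apply/isoP; exists id => [|v]; [exists id | case: (g v)]. Qed.

Lemma iso_trans (U V W : finType) (g : graph U) (h : graph V) (k : graph W) :
  iso g h -> iso h k -> iso g k.
Proof.
move=> /isoP [f fB E] /isoP [f' f'B E']; apply/isoP; exists (f' \o f).
  exact: bij_comp.
by move=> v /=; rewrite E' E; case: (g v).
Qed.

Lemma iso_symW (V W : finType) (g : graph V) (h : graph W) :
  iso g h -> iso h g.
Proof.
move=> /isoP [f [f' fK f'K] E]; apply/isoP; exists f'; first by exists f.
move=> w; rewrite -{2}(f'K w) E.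
by case: (g _) => //= x; rewrite fK.
Qed.

Lemma iso_sym (V W : finType) (g : graph V) (h : graph W) : iso g h = iso h g.
Proof. by apply/idP/idP; exact: iso_symW. Qed.

Definition giso N : rel (graph 'I_N) := fun g h => iso g h.

Lemma giso_equiv N : equiv_class_of (@giso N).
Proof.
split=> [g|g h|h g k]; [exact: iso_refl | exact: iso_sym | exact: iso_trans].
Qed.

Canonical giso_equiv_rel N := EquivRelPack (giso_equiv N).

Definition graph_class N := {eq_quot (giso_equiv_rel N)}.
HB.instance Definition _ N := [Finite of graph_class N by <:%/].
HB.instance Definition _ N := EqQuotient.on (graph_class N).

(* The set F_n^N.  The roots are not numbered: this is F_n^N for n <= 1 only,
   the numbering being then trivial and preserved by every isomorphism. *)
Definition forest n N := {c : graph_class N | is_forest n (repr c)}.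
HB.instance Definition _ n N := Finite.on (forest n N).

Definition forest_graph n N (t : forest n N) : graph 'I_N := repr (val t).

Definition tforest n N := {t : forest n N | ~~ has_loop (forest_graph t)}.
HB.instance Definition _ n N := Finite.on (tforest n N).

Definition tforest_graph n N (t : tforest n N) : graph 'I_N :=
  forest_graph (val t).

Lemma iso_card (V W : finType) (g : graph V) (h : graph W) :
  iso g h -> #|V| = #|W|.
Proof. by move=> /isoP [f fB _]; apply: bij_eq_card fB. Qed.

Lemma iso_has_loop (V W : finType) (g : graph V) (h : graph W) :
  iso g h -> has_loop g = has_loop h.
Proof.
suff H (V' W' : finType) (g' : graph V') (h' : graph W') :
    iso g' h' -> has_loop g' -> has_loop h'.
  by move=> gh; apply/idP/idP; apply: H; rewrite // iso_sym.
move=> /isoP [f _ E] /existsP [v /eqP gv]; apply/existsP; exists (f v).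
by rewrite /edge E gv.
Qed.

Lemma iso_is_forest n (V W : finType) (g : graph V) (h : graph W) :
  iso g h -> is_forest n g = is_forest n h.
Proof.
move=> gh; rewrite /is_forest (iso_card gh); congr (_ && (_ == _)).
case/isoP: gh => f fB E.
rewrite -!sum1_card (reindex f) /=; last exact: onW_bij.
by apply: eq_bigl => v; rewrite !unfold_in /is_root E; case: (g v).
Qed.

Lemma forest_graphP n N (t : forest n N) : is_forest n (forest_graph t).
Proof. exact: valP t. Qed.

Lemma forest_graph_inj n N (t t' : forest n N) :
  iso (forest_graph t) (forest_graph t') -> t = t'.
Proof.
move=> tt'; apply: val_inj; rewrite -[val t]reprK -[val t']reprK.
exact: (elimT (@eqmodP _ (giso_equiv_rel N) _ _) tt').
Qed.

Lemma forest_exists n (V : finType) (g : graph V) :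
  is_forest n g -> exists t : forest n #|V|, iso g (forest_graph t).
Proof.
move=> gn; pose h : graph 'I_#|V| :=
  [ffun i => omap enum_rank (g (enum_val i))].
have gh : iso g h.
  apply/isoP; exists enum_rank; first exact: enum_rank_bij.
  by move=> v; rewrite ffunE enum_rankK.
have hr : iso h (repr (\pi_(graph_class #|V|) h)).
  apply: (introT (@eqmodP _ (giso_equiv_rel #|V|) _ _)).
  by rewrite reprK.
have gr := iso_trans gh hr.
have P : is_forest n (repr (\pi_(graph_class #|V|) h)).
  by rewrite -(iso_is_forest n gr).
by exists (exist _ (\pi_(graph_class #|V|) h) P).
Qed.

Lemma iso_add_edge (V W : finType) (g : graph V) (h : graph W) f u :
  bijective f -> (forall v, h (f v) = omap f (g v)) ->
  iso (add_edge g u) (add_edge h (f u)).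
Proof.
move=> fB E; apply/isoP; exists f => // v.
by rewrite !ffunE E; case: (g v).
Qed.

Lemma iso_graft_at (V1 V2 W1 W2 : finType) (g1 : graph V1) (g2 : graph V2)
    (h1 : graph W1) (h2 : graph W2) f u :
  iso g1 h1 -> bijective f -> (forall v, h2 (f v) = omap f (g2 v)) ->
  iso (graft_at g1 g2 u) (graft_at h1 h2 (f u)).
Proof.
move=> /isoP [f1 [f1' f1K f1'K] E1] [f' fK f'K] E.
apply/isoP.
exists (fun v => match v with inl x => inl (f1 x) | inr x => inr (f x) end).
  by exists (fun v => match v with inl x => inl (f1' x) | inr x => inr (f' x)
                      end) => -[x|x]; congr (_ _).
by move=> [x|x]; rewrite !ffunE ?E1 ?E; [case: (g1 x) | case: (g2 x)].
Qed.

Lemma has_loop_add_edge (V : finType) (g : graph V) u :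
  has_loop g -> has_loop (add_edge g u).
Proof.
move=> /existsP [v /eqP gv]; apply/existsP; exists v.
by rewrite /edge ffunE gv.
Qed.

Lemma has_loop_graft_at (V1 V2 : finType) (g1 : graph V1) (g2 : graph V2) u :
  has_loop g1 || has_loop g2 -> has_loop (graft_at g1 g2 u).
Proof.
by case/orP=> /existsP [v /eqP gv]; apply/existsP;
  [exists (inl v) | exists (inr v)]; rewrite /edge ffunE gv.
Qed.

Definition bullet : graph 'I_1 := [ffun=> None].

Definition Omega (R : realType) n N := {ffun forest n N -> R^o}.
HB.instance Definition _ R n N := Vector.on (Omega R n N).

(* The quotient of [Omega R n N] by the span of the forests with a 1-loop is
   realized on its basis of forests without 1-loops; the quotient map is
   [mod_loops]. *)
Definition tOmega (R : realType) n N := {ffun tforest n N -> R^o}.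
HB.instance Definition _ R n N := Vector.on (tOmega R n N).

Definition mod_loops (R : realType) n N (x : Omega R n N) : tOmega R n N :=
  [ffun t => x (val t)].

(* The basis vector of the isomorphism class of g, provided that g has
   n roots and N nodes (and 0 otherwise). *)
Definition cls (R : realType) n N (V : finType) (g : graph V) : Omega R n N :=
  [ffun t => (iso g (forest_graph t))%:R].

Definition tcls (R : realType) n N (V : finType) (g : graph V) :
    tOmega R n N := mod_loops (cls R n N g).

Lemma mod_loops_surj (R : realType) n N (y : tOmega R n N) :
  exists x : Omega R n N, mod_loops x = y.
Proof.
exists [ffun t => if insub t is Some u then y u else 0].
by apply/ffunP => t; rewrite !ffunE valK.
Qed.

Lemma cls_forest (R : realType) n N (t t' : forest n N) :
  cls R n N (forest_graph t) t' = (t == t')%:R.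
Proof.
suff -> : (t == t') = iso (forest_graph t) (forest_graph t') by rewrite ffunE.
by apply/eqP/idP => [->|/forest_graph_inj //]; rewrite iso_refl.
Qed.

Lemma mod_loops_eq0 (R : realType) n N (x : Omega R n N) :
  mod_loops x = 0 <->
  x \in <<[seq cls R n N (forest_graph t)
         | t : forest n N in [pred t | has_loop (forest_graph t)]]>>%VS.
Proof.
split=> [x0|].
  have -> : x = \sum_t x t *: cls R n N (forest_graph t).
    apply/ffunP => t; rewrite sum_ffunE (bigD1 t) //= big1 ?addr0 => [|t' t't];
      rewrite ffunE cls_forest ?eqxx ?(negPf t't) ?scaler0 //.
    by rewrite /GRing.scale /= mulr1.
  apply: memv_suml => t _; have [Lt|Lt] := boolP (has_loop (forest_graph t)).
    by apply/memvZ/memv_span/image_f.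
  move/ffunP/(_ (exist _ t Lt)): x0; rewrite !ffunE /= => ->.
  by rewrite scale0r mem0v.
move=> xS; apply/ffunP => t; rewrite !ffunE.
rewrite (@coord_span _ _ _ (in_tuple _) _ xS) sum_ffunE big1 // => i _.
rewrite ffunE; set y := _`_i.
have /imageP [t' Lt' ->] : y \in [seq cls R n N (forest_graph t)
    | t : forest n N in [pred t | has_loop (forest_graph t)]].
  exact: mem_nth.
rewrite cls_forest; case: eqP => [tt'|_]; last by rewrite scaler0.
by move: Lt'; rewrite tt' inE (negPf (valP t)).
Qed.

Lemma iso_tcls (R : realType) n N (V W : finType) (g : graph V)
    (h : graph W) :
  iso g h -> tcls R n N g = tcls R n N h.
Proof.
move=> gh; apply/ffunP => t; rewrite !ffunE.
suff -> : iso g (forest_graph (val t)) = iso h (forest_graph (val t)) by [].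
by apply/idP/idP; apply: iso_trans; rewrite // iso_sym.
Qed.

Lemma tcls_loop (R : realType) n N (V : finType) (g : graph V) :
  has_loop g -> tcls R n N g = 0.
Proof.
move=> Lg; apply/ffunP => t; rewrite !ffunE.
case gt: (iso g _) => //; move: (valP t); rewrite /= -(iso_has_loop gt).
by rewrite Lg.
Qed.

Lemma tOmega0 (R : realType) n N (t : tforest n N) :
  (0 : tOmega R n N) t = 0.
Proof. by rewrite ffunE. Qed.

Lemma tcls_card (R : realType) n N (V : finType) (g : graph V) :
  #|V| != N -> tcls R n N g = 0.
Proof.
move=> VN; apply/ffunP => t; rewrite !ffunE.
by case gt: (iso g _) => //; rewrite (iso_card gt) card_ord eqxx in VN.
Qed.

Lemma tcls_tforest (R : realType) n N (t t' : tforest n N) :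
  tcls R n N (tforest_graph t) t' = (t == t')%:R.
Proof. by rewrite ffunE cls_forest. Qed.

Lemma tforest_exists n N (V : finType) (g : graph V) :
  #|V| = N -> is_forest n g -> ~~ has_loop g ->
  exists t : tforest n N, iso g (tforest_graph t).
Proof.
move=> <- gn Lg; have [t gt] := forest_exists gn.
have Lt : ~~ has_loop (forest_graph t) by rewrite -(iso_has_loop gt).
by exists (exist _ t Lt).
Qed.

(* The map induced on the quotients, given on a basis; see [dH_tcls]. *)
Definition dH (R : realType) N (x : tOmega R 1 N) : tOmega R 0 N :=
  \sum_(t : tforest 1 N)
     x t *: \sum_(u : 'I_N) tcls R 0 N (add_edge (tforest_graph t) u).

Lemma dH_tcls (R : realType) N (V : finType) (g : graph V) :
  is_forest 1 g ->
  dH (tcls R 1 N g) = \sum_(u : V) tcls R 0 N (add_edge g u).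
Proof.
move=> g1; have [VN|VN] := eqVneq #|V| N; last first.
  rewrite tcls_card // big1 => [|u _]; last by rewrite tcls_card.
  by rewrite /dH big1 // => t _; rewrite ffunE scale0r.
have [Lg|Lg] := boolP (has_loop g).
  rewrite tcls_loop // big1 => [|u _]; last first.
    by rewrite tcls_loop // has_loop_add_edge.
  by rewrite /dH big1 // => t _; rewrite ffunE scale0r.
have [t gt] := tforest_exists VN g1 Lg.
rewrite (iso_tcls R _ _ gt) /dH (bigD1 t) //= tcls_tforest eqxx scale1r.
rewrite [X in _ + X]big1 ?addr0 => [|t' t't]; last first.
  by rewrite tcls_tforest eq_sym (negPf t't) scale0r.
case/isoP: gt => f fB E; rewrite (reindex f) /=; last exact: onW_bij.
by apply: eq_bigr => u _; apply/esym/iso_tcls/iso_add_edge.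
Qed.

Definition series (R : realType) n := forall N : nat, tOmega R n N.

Definition dHs (R : realType) (X : series R 1) : series R 0 :=
  fun N => dH (X N).

Definition graft (R : realType) (X Y : series R 1) : series R 1 := fun N =>
  \sum_(i < N.+1) \sum_(j < N.+1 | (i + j)%N == N)
    \sum_(t1 : tforest 1 i) \sum_(t2 : tforest 1 j)
      (X i t1 * Y j t2) *:
        \sum_(u : 'I_j)
          tcls R 1 N (graft_at (tforest_graph t1) (tforest_graph t2) u).

Lemma graft_tcls (R : realType) N (V1 V2 : finType) (g1 : graph V1)
    (g2 : graph V2) :
  is_forest 1 g1 -> is_forest 1 g2 ->
  graft (fun M => tcls R 1 M g1) (fun M => tcls R 1 M g2) N =
  \sum_(u : V2) tcls R 1 N (graft_at g1 g2 u).
Proof.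
move=> F1 F2.
have [L|] := boolP (has_loop g1 || has_loop g2).
  rewrite [RHS]big1 => [|u _]; last by rewrite tcls_loop ?has_loop_graft_at.
  rewrite /graft; apply: big1 => i _; apply: big1 => j _.
  apply: big1 => t1 _; apply: big1 => t2 _.
  by case/orP: L => L; rewrite (tcls_loop _ _ _ L) tOmega0 ?mul0r ?mulr0
    scale0r.
rewrite negb_or => /andP [L1 L2].
have [VN|VN] := eqVneq (#|V1| + #|V2|)%N N; last first.
  rewrite [RHS]big1 => [|u _]; last by rewrite tcls_card // card_sum.
  rewrite /graft; apply: big1 => i _; apply: big1 => j /eqP ij.
  apply: big1 => t1 _; apply: big1 => t2 _.
  have [E1|E1] := eqVneq #|V1| i; last first.
    by rewrite (tcls_card _ _ _ E1) tOmega0 mul0r scale0r.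
  have [E2|E2] := eqVneq #|V2| j; last first.
    by rewrite (tcls_card _ _ _ E2) tOmega0 mulr0 scale0r.
  by rewrite E1 E2 ij eqxx in VN.
have [t1 gt1] := tforest_exists (erefl _) F1 L1.
have [t2 gt2] := tforest_exists (erefl _) F2 L2.
have lt1 : (#|V1| < N.+1)%N by rewrite -VN ltnS leq_addr.
have lt2 : (#|V2| < N.+1)%N by rewrite -VN ltnS leq_addl.
rewrite /graft (bigD1 (Ordinal lt1)) //= [X in _ + X]big1 ?addr0; last first.
  move=> i iV; apply: big1 => j _; apply: big1 => s1 _; apply: big1 => s2 _.
  have E1 : #|V1| != i by rewrite eq_sym.
  by rewrite (tcls_card _ _ _ E1) tOmega0 mul0r scale0r.
rewrite (bigD1 (Ordinal lt2)) ?VN //= [X in _ + X]big1 ?addr0; last first.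
  move=> j /andP [_ jV]; apply: big1 => s1 _; apply: big1 => s2 _.
  have E2 : #|V2| != j by rewrite eq_sym.
  by rewrite (tcls_card _ _ _ E2) tOmega0 mulr0 scale0r.
rewrite (iso_tcls R _ _ gt1) (iso_tcls R _ _ gt2).
rewrite (bigD1 t1) //= [X in _ + X]big1 ?addr0; last first.
  move=> s1 s1t; apply: big1 => s2 _.
  by rewrite tcls_tforest eq_sym (negPf s1t) mul0r scale0r.
rewrite (bigD1 t2) //= [X in _ + X]big1 ?addr0; last first.
  move=> s2 s2t.
  by rewrite [X in _ * X]tcls_tforest eq_sym (negPf s2t) mulr0 scale0r.
rewrite !tcls_tforest !eqxx mulr1 scale1r.
case/isoP: gt2 => f fB E; rewrite (reindex f) /=; last exact: onW_bij.
by apply: eq_bigr => u _; apply/esym/iso_tcls/iso_graft_at.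
Qed.

Lemma graft_eq0 (R : realType) (X Y : series R 1) k N :
  (forall M, (M <= k)%N -> Y M = 0) -> (N <= k.+1)%N -> graft X Y N = 0.
Proof.
move=> Y0 Nk; rewrite /graft; apply: big1 => i _; apply: big1 => j /eqP ij.
apply: big1 => t1 _; apply: big1 => t2 _.
have i_gt0 : (0 < i)%N.
  by case/andP: (forest_graphP (val t1)); rewrite card_ord.
rewrite Y0 ?ffunE ?mulr0 ?scale0r // -ltnS; apply: leq_trans Nk.
by rewrite -[X in (_ <= X)%N]ij -[X in (X < _)%N]add0n ltn_add2r.
Qed.

(* [graft_pow X k] is X^[k+1]. *)
Definition graft_pow (R : realType) (X : series R 1) (k : nat) : series R 1 :=
  iter k (graft X) X.

Lemma graft_pow_eq0 (R : realType) (X : series R 1) k N :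
  (N <= k)%N -> graft_pow X k N = 0.
Proof.
elim: k N => [|k IHk] N Nk; last exact: graft_eq0 IHk Nk.
apply/ffunP => t; case/andP: (forest_graphP (val t)).
by rewrite card_ord; case: N Nk t.
Qed.

(* The sum of X^[k] / k! over k >= 1.  The terms with k > N have no component
   of degree N: see [graft_pow_eq0]. *)
Definition exp_series (R : realType) (X : series R 1) : series R 1 := fun N =>
  \sum_(k < N) ((k.+1)`!%:R)^-1 *: graft_pow X k N.

(* Linear maps from the direct sum of the [tOmega R 1 N] to R. *)
Definition coeff_map (R : realType) := forall N : nat, {scalar tOmega R 1 N}.

Definition Bseries (R : realType) (a : coeff_map R) : series R 1 := fun N =>
  \sum_(t : tforest 1 N)
    (a N (tcls R 1 N (tforest_graph t)) / (nb_aut (tforest_graph t))%:R)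
      *: tcls R 1 N (tforest_graph t).

(* The equation b * e = a, where * is the substitution law and b * e is defined
   by B(b * e) = exp_series (Bseries b). *)
Definition modified_field (R : realType) (a b : coeff_map R) :=
  Bseries a = exp_series (Bseries b) :> (forall N, tOmega R 1 N).

Definition consistent (R : realType) (a : coeff_map R) :=
  a 1%N (tcls R 1 1 bullet) = 1.

Definition elementary_weight (R : realType) s (A : 'M[R]_s) (w : 'rV[R]_s)
    (V : finType) (g : graph V) : R :=
  \sum_(i : {ffun V -> 'I_s})
    (\prod_(r | is_root g r) w 0 (i r)) *
    \prod_(p : V * V | edge g p.1 p.2) A (i p.2) (i p.1).

Definition aromatic_RK (R : realType) (a : coeff_map R) :=
  exists (s : nat) (A : 'M[R]_s) (w : 'rV[R]_s), (0 < s)%N /\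
    forall N (t : forest 1 N), connected (forest_graph t) ->
      a N (tcls R 1 N (forest_graph t)) =
      elementary_weight A w (forest_graph t).

Definition volume_preserving (R : realType) (b : coeff_map R) :=
  dHs (Bseries b) = (fun N => 0) :> (forall N, tOmega R 0 N).

(* Main.v *)
Require Import Defs.
From HB Require Import structures.
From mathcomp Require Import all_boot all_order all_algebra.
From mathcomp Require Import reals.

(** The whole proof is carried by one family of forests, the ladders L_N (the
    tree with N nodes and a single leaf), and by the coefficient of L_N in a
    series.

    Closing a one-rooted forest by an edge that starts at its root gives the
    N-cycle only if the forest is L_N ([cycle_minus_edge]), and then exactly when
    the edge ends at the leaf.  Hence, for N >= 2, the coefficient of the N-cycle in
    d_H B(b) is that of L_N in B(b), and volume preservation forces b(L_N) = 0
    ([dH_cycle_coef_eq0]).  The bound N >= 2 is where the quotient by 1-loops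
    matters: the 1-cycle is zero there, so that b(L_1) = 1 is possible.

    A graft of two forests is a ladder only if both are ladders and the second
    one receives the first at its leaf.  So X |-> \sum_N X(L_N) z^N turns
    grafting into multiplication of power series ([ladder_coef_graft]); it
    sends B(b) to z, whence B(a) = \sum_k B(b)^[k] / k! is sent to e^z - 1, that
    is, a(L_N) = 1/N! ([ladder_coef_exp]).

    For a Runge-Kutta method with matrix A and weights w, a(L_N) is
    w A^(N-1) (1, ..., 1)^T ([elementary_weight_ladder]): the power series above
    is rational, 1 plus it being the stability function.  But e^z is not
    rational.  Concretely, Cayley-Hamilton gives a linear recurrence with
    constant coefficients and leading coefficient 1 for a(L_N)
    ([mx_pow_recurrence]), and the inverse factorials satisfy none
    ([inv_fact_not_recurrent]). *)

Set Implicit Arguments.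
Unset Strict Implicit.
Unset Printing Implicit Defensive.

Import GRing.Theory Num.Theory.
Local Open Scope ring_scope.

(** * Ladders and depth of nodes *)

(** Node 0 is the root; the edges are (k+1, k), so that the value of a node is
    its distance to the root. *)
Definition ladder N : graph 'I_N :=
  [ffun i : 'I_N => if (i : nat) is k.+1 then insub k else None].

(** A predicate and not a function: the nodes of an aroma have no depth. *)
Fixpoint has_depth (V : finType) (g : graph V) (n : nat) (v : V) : bool :=
  match g v, n with
  | None, 0 => true
  | Some w, m.+1 => has_depth g m w
  | _, _ => false
  end.

Section Depth.
Variables (V : finType) (g : graph V).

Lemma has_depth0 v : has_depth g 0 v = (g v == None).
Proof. by rewrite /=; case: (g v). Qed.

Lemma has_depthS n v w : g v = Some w -> has_depth g n.+1 v = has_depth g n w.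
Proof. by move=> /= ->. Qed.

Lemma has_depth_uniq m n v : has_depth g m v -> has_depth g n v -> m = n.
Proof.
elim: m n v => [|m IH] [|n] v //=; case: (g v) => // w dm dn.
by rewrite (IH n w).
Qed.

Lemma has_depth_below n v m :
  has_depth g n v -> (m <= n)%N -> exists w, has_depth g m w.
Proof.
elim: n v => [|n IH] v dv; first by rewrite leqn0 => /eqP ->; exists v.
rewrite leq_eqVlt => /predU1P [->|]; first by exists v.
by move: dv => /=; case: (g v) => // w /IH.
Qed.

(** The nodes on the path from v to its root have depths n, ..., 0, so they are
    distinct. *)
Lemma depth_section n v :
  has_depth g n v ->
  exists2 f : 'I_n.+1 -> V, injective f & forall i : 'I_n.+1,
    has_depth g i (f i).
Proof.
move=> dv; have ex (i : 'I_n.+1) : exists w, has_depth g i w.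
  by apply: has_depth_below dv _; rewrite -ltnS.
exists (fun i => xchoose (ex i)) => [i j ij|i]; last exact: xchooseP.
apply/val_inj/(has_depth_uniq (xchooseP (ex i))).
by rewrite ij; apply: xchooseP.
Qed.

Lemma has_depth_lt_card n v : has_depth g n v -> (n < #|V|)%N.
Proof.
by case/depth_section => f fI _; have := leq_card f fI; rewrite card_ord.
Qed.

End Depth.

Lemma iso_has_depth (V W : finType) (g : graph V) (h : graph W) (f : V -> W) :
  (forall v, h (f v) = omap f (g v)) ->
  forall n v, has_depth h n (f v) = has_depth g n v.
Proof.
by move=> E; elim=> [|n IH] v /=; rewrite E; case: (g v) => //= w; apply: IH.
Qed.

Lemma ladder_root N (i : 'I_N) : i = 0%N :> nat -> ladder N i = None.
Proof. by rewrite ffunE => ->. Qed.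

Lemma ladder_edge N (i j : 'I_N) : i = j.+1 :> nat -> ladder N i = Some j.
Proof. by rewrite ffunE => ->; rewrite valK. Qed.

Lemma has_depth_ladder N n (i : 'I_N) : has_depth (ladder N) n i = (n == i).
Proof.
elim: n i => [|n IH] i; case: (posnP i) => [i0|i_gt0] /=.
- by rewrite (ladder_root i0) i0.
- have lt_p : (i.-1 < N)%N by rewrite (leq_ltn_trans (leq_pred _) (ltn_ord i)).
  rewrite (@ladder_edge _ i (Ordinal lt_p)) /= ?prednK //.
  by apply/esym/negbTE; rewrite neq_ltn i_gt0.
- by rewrite (ladder_root i0) i0.
- have lt_p : (i.-1 < N)%N by rewrite (leq_ltn_trans (leq_pred _) (ltn_ord i)).
  rewrite (@ladder_edge _ i (Ordinal lt_p)) /= ?prednK // IH /=.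
  by rewrite -eqSS prednK.
Qed.

(** The test for ladders used throughout: a path with as many nodes as the
    graph exhausts the graph, which leaves no room for aromas or branching. *)
Lemma iso_ladderP (V : finType) (g : graph V) n :
  #|V| = n.+1 ->
  reflect (exists v, has_depth g n v) (iso (ladder n.+1) g).
Proof.
move=> cV; apply: (iffP idP) => [/isoP [f fB E]|[v /depth_section [f fI dp]]].
  by exists (f ord_max); rewrite (iso_has_depth E) has_depth_ladder.
have fB : bijective f by apply: inj_card_bij fI _; rewrite cV card_ord.
apply/isoP; exists f => // i; have := dp i; case: fB => f' fK f'K.
case: (posnP i) => [i0|i_gt0].
  by rewrite i0 has_depth0 (ladder_root i0) => /eqP.
have lt_p : (i.-1 < n.+1)%N by rewrite (leq_ltn_trans (leq_pred _) (ltn_ord i)).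
rewrite (@ladder_edge _ i (Ordinal lt_p)) /= ?prednK // -{1}(prednK i_gt0) /=.
case: (g (f i)) => // w dw; congr Some.
rewrite -(f'K w); congr f; apply: val_inj => /=.
by apply: has_depth_uniq (dp _) _; rewrite f'K.
Qed.

(** The leaf of a ladder is thus the only node at which a graft on it can give a
    ladder. *)
Lemma iso_ladder_top (V : finType) (g : graph V) n u v :
  iso (ladder n.+1) g -> has_depth g n u -> has_depth g n v -> u = v.
Proof.
move=> /isoP [f [f' fK f'K] E].
rewrite -(f'K u) -(f'K v) !(iso_has_depth E) !has_depth_ladder.
by move=> /eqP nu /eqP nv; congr f; apply: val_inj; rewrite /= -nu -nv.
Qed.

Section Graft.
Variables (V1 V2 : finType) (g1 : graph V1) (g2 : graph V2) (u : V2).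

Lemma has_depth_graft_inr n x :
  has_depth (graft_at g1 g2 u) n (inr x) = has_depth g2 n x.
Proof. by elim: n x => [|n IH] x /=; rewrite ffunE; case: (g2 x) => /=. Qed.

(** A path that starts in g1 runs to the root of g1, jumps to u and goes on in
    g2; the jump is the extra unit. *)
Lemma has_depth_graft_inl n x :
  reflect (exists m k, [/\ n = (m + k).+1, has_depth g1 m x & has_depth g2 k u])
          (has_depth (graft_at g1 g2 u) n (inl x)).
Proof.
elim: n x => [|n IH] x.
  by rewrite /= ffunE; case: (g1 x) => [y|]; constructor=> -[m [k []]].
rewrite /= ffunE; case gx: (g1 x) => [y|].
  apply: (iffP (IH y)) => -[m [k []]].
    by move=> -> dm dk; exists m.+1, k; rewrite /= gx.
  move=> [->] dm dk.
  by case: m dm {IH} => [|m]; rewrite /= gx // => dm; exists m, k.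
rewrite has_depth_graft_inr; apply: (iffP idP) => [du|[m [k []]]].
  by exists 0%N, n; rewrite has_depth0 gx.
by case: m => [|m]; rewrite /= gx // => -[->].
Qed.

(** A path with n1.+1 + n2.+1 nodes cannot start in g2, and each of its two
    portions is bounded by the number of nodes on its side, so both bounds are
    attained: g1 is a ladder, g2 is a ladder and u is its leaf. *)
Lemma iso_ladder_graft n1 n2 : #|V1| = n1.+1 -> #|V2| = n2.+1 ->
  iso (ladder (n1.+1 + n2.+1)) (graft_at g1 g2 u) =
  iso (ladder n1.+1) g1 && has_depth g2 n2 u.
Proof.
move=> c1 c2; have c : #|{: V1 + V2}| = (n1.+1 + n2).+1.
  by rewrite card_sum c1 c2 addnS.
rewrite addnS.
apply/(iso_ladderP _ c)/andP => [[[x|x]]|[/(iso_ladderP _ c1) [x dx] du]].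
- case/has_depth_graft_inl => m [k [[mk] dm dk]].
  have lm := has_depth_lt_card dm; have lk := has_depth_lt_card dk.
  rewrite c1 ltnS in lm; rewrite c2 ltnS in lk.
  have em : m = n1.
    apply/eqP; rewrite eqn_leq lm -(leq_add2r n2) mk leq_add2l lk //.
  have ek : k = n2 by apply/eqP; rewrite -(eqn_add2l m) -mk em.
  by split; [apply/(iso_ladderP _ c1); exists x; rewrite -em | rewrite -ek].
- rewrite has_depth_graft_inr => /has_depth_lt_card.
  by rewrite c2 ltnS addSn ltnNge leq_addl.
- by exists (inl x); apply/has_depth_graft_inl; exists n1, n2.
Qed.

End Graft.

Lemma sum_iso_ladder_graft (R : realType) (V1 V2 : finType) (g1 : graph V1)
    (g2 : graph V2) n1 n2 : #|V1| = n1.+1 -> #|V2| = n2.+1 ->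
  \sum_(u : V2) (iso (ladder (n1.+1 + n2.+1)) (graft_at g1 g2 u))%:R =
  (iso (ladder n1.+1) g1)%:R * (iso (ladder n2.+1) g2)%:R :> R.
Proof.
move=> c1 c2; under eq_bigr => u _ do rewrite iso_ladder_graft // -mulnb natrM.
rewrite -mulr_sumr; congr (_ * _).
have [L|nL] := boolP (iso (ladder n2.+1) g2).
  have [u du] := iso_ladderP _ c2 L.
  rewrite (bigD1 u) //= du big1 ?addr0 // => v vu.
  case dv: (has_depth g2 n2 v) => //.
  by rewrite (iso_ladder_top L dv du) eqxx in vu.
rewrite big1 // => u _; case du: (has_depth g2 n2 u) => //.
by case/(iso_ladderP _ c2): nL; exists u.
Qed.

Lemma ladder_forest n : is_forest 1 (ladder n.+1).
Proof.
rewrite /is_forest card_ord /=; apply/eqP.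
rewrite (eq_card (B := pred1 ord0)) ?card1 // => i.
by rewrite !inE unfold_in /is_root -has_depth0 has_depth_ladder eq_sym.
Qed.

Lemma ladder_no_loop N : ~~ has_loop (ladder N).
Proof.
apply/existsP => -[i /eqP Li].
have : has_depth (ladder N) i.+1 i.
  by rewrite (has_depthS _ Li) has_depth_ladder.
by rewrite has_depth_ladder gtn_eqF.
Qed.

Lemma ladder_bullet : iso (ladder 1) bullet.
Proof.
apply/(@iso_ladderP _ _ 0); first by rewrite card_ord.
by exists ord0; rewrite has_depth0 ffunE.
Qed.

(** An automorphism preserves the depth, which determines the node. *)
Lemma nb_aut_ladder (V : finType) (g : graph V) n :
  iso (ladder n.+1) g -> nb_aut g = 1%N.
Proof.
move=> /isoP [f fB E]; case: (fB) => f' fK f'K.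
rewrite /nb_aut; apply/eqP/cards1P; exists [ffun v => v].
apply/setP => p; rewrite !inE; apply/is_isoP/eqP => [[pB Ep]|->].
  apply/ffunP => v; rewrite ffunE -(f'K v); set i := f' v.
  have := iso_has_depth Ep i (f i).
  rewrite -(f'K (p _)) !(iso_has_depth E) !has_depth_ladder eqxx => /eqP ij.
  by congr f; apply: val_inj.
split=> [|v]; first by exists id => v; rewrite ffunE.
by rewrite ffunE; case: (g v) => //= w; rewrite ffunE.
Qed.

(** Needed because elementary weights prescribe a on connected forests
    only. *)
Lemma connected_ladder (V : finType) (g : graph V) n :
  iso (ladder n.+1) g -> connected g.
Proof.
move=> gL; have /isoP [f [f' fK f'K] E] := gL.
set e := fun x y => edge g x y || edge g y x.
have esym : connect_sym e by apply: sym_connect_sym => x y; rewrite /e orbC.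
have toroot v : connect e v (f ord0).
  rewrite -(f'K v); case: (f' v) => k; elim: k => [|k IH] lk.
    by rewrite (_ : Ordinal lk = ord0) ?connect0 //; apply: val_inj.
  have lk' : (k < n.+1)%N by apply: ltnW.
  apply: connect_trans (IH lk'); apply: connect1.
  by rewrite /e /edge E (@ladder_edge _ _ (Ordinal lk')) //= eqxx.
apply/forallP => v; apply/forallP => w.
by apply: connect_trans (toroot v) _; rewrite esym.
Qed.

(** * The coefficient of a ladder in a series *)

Section Coef.
Variable R : realType.

(** The sum has a single term when 0 < N.  As a sum it needs no choice of a
    representative of the ladder, and it is 0 for N = 0. *)
Definition ladder_coef N (x : tOmega R 1 N) : R :=
  \sum_(t : tforest 1 N | iso (ladder N) (tforest_graph t)) x t.

Fact ladder_coef_is_linear N : scalar (@ladder_coef N).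
Proof.
move=> c x y; rewrite /ladder_coef mulr_sumr -big_split /=.
by apply: eq_bigr => t _; rewrite !ffunE.
Qed.

HB.instance Definition _ N :=
  GRing.isLinear.Build R (tOmega R 1 N) R _ (@ladder_coef N)
    (@ladder_coef_is_linear N).

Lemma ladder_coefE n (t : tforest 1 n.+1) (x : tOmega R 1 n.+1) :
  iso (ladder n.+1) (tforest_graph t) -> ladder_coef x = x t.
Proof.
move=> Lt; rewrite /ladder_coef (bigD1 t) //= big1 ?addr0 // => t'.
case/andP=> Lt' /eqP []; apply/val_inj/forest_graph_inj.
by apply: iso_trans Lt; rewrite iso_sym.
Qed.

Lemma ladder_coef_tcls n (V : finType) (g : graph V) :
  ladder_coef (tcls R 1 n.+1 g) = (iso (ladder n.+1) g)%:R.
Proof.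
have [t Lt] := tforest_exists (card_ord _) (ladder_forest n) (ladder_no_loop _).
rewrite (ladder_coefE _ Lt) !ffunE; congr (_ : bool)%:R.
apply/idP/idP => H; last by apply: iso_trans Lt; rewrite iso_sym.
by apply: iso_trans Lt _; rewrite iso_sym.
Qed.

Lemma tforest_gt0 n N (t : tforest n N) : (0 < N)%N.
Proof. by case/andP: (forest_graphP (val t)); rewrite card_ord. Qed.

Lemma ladder_coef_graft_basis i j N (t1 : tforest 1 i) (t2 : tforest 1 j) :
  (i + j)%N = N ->
  \sum_(u : 'I_j)
    ladder_coef (tcls R 1 N (graft_at (tforest_graph t1) (tforest_graph t2) u))
  = (iso (ladder i) (tforest_graph t1))%:R *
    (iso (ladder j) (tforest_graph t2))%:R.
Proof.
move=> <-; move: (tforest_gt0 t1) (tforest_gt0 t2).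
case: i j t1 t2 => [|i] [|j] // t1 t2 _ _.
under eq_bigr => u _ do rewrite ladder_coef_tcls.
by apply: sum_iso_ladder_graft; rewrite card_ord.
Qed.

(** Among the grafts of t1 on the nodes of t2, one is a ladder if both t1 and t2
    are, and none otherwise.  Hence the generating series of the ladder
    coefficients are multiplied. *)
Lemma ladder_coef_graft (X Y : series R 1) N :
  ladder_coef (graft X Y N) =
  \sum_(i < N.+1) \sum_(j < N.+1 | (i + j)%N == N)
    ladder_coef (X i) * ladder_coef (Y j).
Proof.
rewrite /graft linear_sum; apply: eq_bigr => i _.
rewrite linear_sum; apply: eq_bigr => j /eqP ij.
rewrite linear_sum [ladder_coef (X i)]big_mkcond mulr_suml.
apply: eq_bigr => t1 _; rewrite linear_sum [ladder_coef (Y j)]big_mkcond.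
rewrite mulr_sumr; apply: eq_bigr => t2 _.
rewrite linearZ linear_sum /= ladder_coef_graft_basis //.
by do 2!case: (iso _ _); rewrite /= ?(mulr0, mul0r, mulr1).
Qed.

(** The hypothesis says that the generating series of X is z, and that of the
    power is then z^(k.+1). *)
Lemma ladder_coef_graft_pow (X : series R 1) k N :
  (forall M, ladder_coef (X M) = (M == 1%N)%:R) ->
  ladder_coef (graft_pow X k N) = (N == k.+1)%:R.
Proof.
move=> X1; elim: k N => [|k IH] [|N]; rewrite ?X1 //.
  rewrite ladder_coef_graft big_ord1 big1 // => j _.
  by rewrite X1 mul0r.
rewrite ladder_coef_graft 2!big_ord_recl /= X1 big1 ?add0r => [|j _];
  last by rewrite mul0r.
rewrite [X in _ + X]big1 ?addr0 => [|i _]; last first.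
  by rewrite big1 // => j _; rewrite X1 mul0r.
(* Only i = 1 is left, and it forces j = N. *)
rewrite (eq_bigl (fun j => j == inord N)) => [|j]; last first.
  by rewrite -val_eqE /= inordK // add1n eqSS.
by rewrite big_pred1_eq X1 IH mul1r inordK.
Qed.

Lemma ladder_coef_exp (X : series R 1) N :
  (forall M, ladder_coef (X M) = (M == 1%N)%:R) ->
  ladder_coef (exp_series X N.+1) = (N.+1`!%:R)^-1.
Proof.
move=> X1; rewrite /exp_series linear_sum big_ord_recr /= big1 => [|k _].
  by rewrite add0r linearZ /= ladder_coef_graft_pow // eqxx mulr1.
by rewrite linearZ /= ladder_coef_graft_pow // eqSS gtn_eqF ?mulr0.
Qed.

Lemma ladder_coef_exp1 (X : series R 1) :
  ladder_coef (exp_series X 1%N) = ladder_coef (X 1%N).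
Proof. by rewrite /exp_series big_ord1 /= invr1 scale1r. Qed.

Lemma BseriesE (a : coeff_map R) N (t : tforest 1 N) :
  Bseries a N t =
  a N (tcls R 1 N (tforest_graph t)) / (nb_aut (tforest_graph t))%:R.
Proof.
rewrite /Bseries sum_ffunE (bigD1 t) //= big1 ?addr0 => [|s st].
  by rewrite ffunE tcls_tforest eqxx; apply: mulr1.
by rewrite ffunE tcls_tforest (negPf st); apply: mulr0.
Qed.

Lemma ladder_coef_Bseries (a : coeff_map R) n :
  ladder_coef (Bseries a n.+1 : tOmega R 1 n.+1) =
  a n.+1 (tcls R 1 n.+1 (ladder n.+1)).
Proof.
have [t Lt] := tforest_exists (card_ord _) (ladder_forest n) (ladder_no_loop _).
rewrite (ladder_coefE _ Lt) BseriesE (nb_aut_ladder Lt) divr1.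
by rewrite (iso_tcls _ _ _ Lt).
Qed.

Lemma ladder_coef0 (x : tOmega R 1 0) : ladder_coef x = 0.
Proof. by rewrite /ladder_coef big1 // => t; have := tforest_gt0 t. Qed.

End Coef.

(** * Cycles and the horizontal differential *)

(** In this form, the cycle is visibly a term of the differential of the
    ladder. *)
Definition cycle_graph n := add_edge (ladder n.+2) ord_max.

(** In the cyclic group of indices, every edge of the cycle is a step by -1. *)
Lemma cycle_graphE n i : cycle_graph n i = Some (i - 1).
Proof.
rewrite -[i in LHS](subrK 1); move: (i - 1) => {}i; rewrite ffunE.
have [->|i_max] := eqVneq i ord_max.
  by rewrite ladder_root //= modnDmr addn1 modnn.
suff -> : ladder n.+2 (i + 1) = Some i by [].
apply: ladder_edge; rewrite /= modnDmr addn1 modn_small //.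
by rewrite ltnS ltn_neqAle -ltnS ltn_ord andbT; apply: contra i_max => /eqP e;
  apply/eqP/val_inj.
Qed.

Lemma cycle_graph_forest n : is_forest 0 (cycle_graph n).
Proof.
rewrite /is_forest card_ord /=; apply/eqP/eq_card0 => i.
by rewrite unfold_in /is_root cycle_graphE.
Qed.

Lemma cycle_graph_no_loop n : ~~ has_loop (cycle_graph n).
Proof.
apply/existsP => -[i]; rewrite /edge cycle_graphE => /eqP [] /eqP.
by rewrite -subr_eq0 addrAC subrr sub0r oppr_eq0 oner_eq0.
Qed.

(** Going backwards around the cycle from the root r, the m-th node has depth m
    in g as long as m < n.+2, since r is not met again before. *)
Lemma cycle_minus_edge (V : finType) (g : graph V) u n :
  is_forest 1 g -> iso (add_edge g u) (cycle_graph n) -> iso (ladder n.+2) g.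
Proof.
move=> /andP [_ /eqP /mem_card1 [r rE]] gc.
apply/iso_ladderP; first by rewrite (iso_card gc) card_ord.
have root v : (g v == None) = (v == r) by have := rE v; rewrite !inE.
case/isoP: gc => f [f' fK f'K] E.
suff walk m : (m < n.+2)%N -> has_depth g m (f' (f r + m%:R)).
  by exists (f' (f r + n.+1%:R)); apply: walk.
elim: m => [_|m IH lt_m].
  by rewrite addr0 fK has_depth0 root.
set v := f' _; case gv: (g v) (root v) => [w|]; last first.
  rewrite eqxx => /esym/eqP vr.
  have /eqP : f v = f r by rewrite vr.
  rewrite f'K -subr_eq0 addrAC subrr add0r Zp_nat => /eqP /(congr1 val) /=.
  by rewrite modn_small.
move=> _; rewrite (has_depthS _ gv).
have := E v; rewrite cycle_graphE ffunE gv /= => -[fw].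
rewrite -[w]fK -fw f'K -natr1 addrA addrK.
by apply: IH; apply: ltnW.
Qed.

(** Only the ladder contributes to the coefficient of the cycle in dH x, and it
    does so a positive number of times. *)
Lemma dH_cycle_coef_eq0 (R : realType) n (c : tforest 0 n.+2)
    (x : tOmega R 1 n.+2) :
  iso (cycle_graph n) (tforest_graph c) -> dH x c = 0 -> ladder_coef x = 0.
Proof.
move=> Lc.
have [t Lt] := tforest_exists (card_ord _) (ladder_forest n.+1)
  (ladder_no_loop _).
have cE (s : tforest 1 n.+2) :
    (\sum_(u : 'I_n.+2) tcls R 0 n.+2 (add_edge (tforest_graph s) u)) c =
    (\sum_(u : 'I_n.+2)
       iso (add_edge (tforest_graph s) u) (tforest_graph c))%:R.
  by rewrite sum_ffunE natr_sum; apply: eq_bigr => u _; rewrite !ffunE.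
rewrite /dH sum_ffunE (bigD1 t) //= [X in _ + X]big1 ?addr0 => [|s st];
  last first.
  rewrite ffunE cE big1 ?scaler0 // => u _; case sc: (iso _ _) => //.
  have Ls : iso (ladder n.+2) (tforest_graph s).
    apply: cycle_minus_edge (forest_graphP _) _.
    by apply: iso_trans sc _; rewrite iso_sym.
  case/eqP: st; apply/val_inj/forest_graph_inj.
  by apply: iso_trans Lt; rewrite iso_sym.
rewrite ffunE cE (ladder_coefE _ Lt) => /eqP; rewrite mulf_eq0 pnatr_eq0.
case/orP => [/eqP //|]; have /isoP [f fB E] := Lt.
rewrite sum_nat_eq0 => /forallP /(_ (f ord_max)) /=.
suff -> : iso (add_edge (tforest_graph t) (f ord_max)) (tforest_graph c) by [].
by apply: iso_trans Lc; rewrite iso_sym; apply: iso_add_edge.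
Qed.

(** * Elementary weights of ladders *)

Lemma elementary_weight_iso (R : realType) s (A : 'M[R]_s) w (V W : finType)
   (g : graph V) (h : graph W) : iso g h ->
  elementary_weight A w g = elementary_weight A w h.
Proof.
move=> /isoP [f [f' fK f'K] E]; rewrite /elementary_weight.
rewrite (reindex (fun i : {ffun W -> 'I_s} => [ffun v => i (f v)])) /=;
  last first.
  exists (fun i : {ffun V -> 'I_s} => [ffun w => i (f' w)]) => i _;
    by apply/ffunP => x; rewrite !ffunE ?fK ?f'K.
apply: eq_bigr => i _; congr (_ * _).
  rewrite [RHS](reindex f) /=; last by exists f' => x _.
  by apply: eq_big => [v|v _]; rewrite ?ffunE // /is_root E; case: (g v).
rewrite [RHS](reindex (fun p => (f p.1, f p.2))) /=; last first.
  by exists (fun p => (f' p.1, f' p.2)) => -[x y] _; rewrite /= ?fK ?f'K.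
apply: eq_big => [[x y]|[x y] _] /=; rewrite ?ffunE // /edge E.
by case: (g x) => //= z; rewrite !(inj_eq (Some_inj)) ?(can_eq fK).
Qed.

Lemma sum_ffun_ord_recl (R : nmodType) (T : finType) n
    (F : {ffun 'I_n.+1 -> T} -> R) :
  \sum_i F i =
  \sum_(x : T) \sum_(j : {ffun 'I_n -> T})
    F [ffun k => oapp j x (unlift ord0 k)].
Proof.
rewrite pair_big (reindex (fun p : T * {ffun 'I_n -> T} =>
  [ffun k => oapp p.2 p.1 (unlift ord0 k)])) //=.
exists (fun i : {ffun 'I_n.+1 -> T} => (i ord0, [ffun k => i (lift ord0 k)])).
  move=> [x j] _ /=; congr (_, _); first by rewrite ffunE unlift_none.
  by apply/ffunP => k; rewrite !ffunE liftK.
move=> i _; apply/ffunP => k; rewrite !ffunE.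
by case: unliftP => [j|] -> //=; rewrite ffunE.
Qed.

(** The induction absorbs the first factor A into the row vector w. *)
Lemma mx_pow_paths (R : comNzRingType) s (A : 'M[R]_s) n (w : 'rV_s) :
  \sum_(i : {ffun 'I_n.+1 -> 'I_s}) w 0 (i ord0) *
     \prod_(k < n) A (i (widen_ord (leqnSn n) k)) (i (lift ord0 k)) =
  (w *m A ^+ n *m const_mx 1 : 'M_1) 0 0.
Proof.
elim: n w => [|n IH] w; rewrite sum_ffun_ord_recl.
  rewrite expr0 mulmx1 mxE; apply: eq_bigr => x _.
  under eq_bigr do rewrite big_ord0 ffunE unlift_none /=.
  by rewrite sumr_const card_ffun !card_ord expn0 mxE.
rewrite exprS -mulmxE mulmxA -IH exchange_big /=; apply: eq_bigr => j _.
rewrite mxE mulr_suml; apply: eq_bigr => x _.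
rewrite big_ord_recl mulrA /=; congr (_ * _ * _).
- by rewrite ffunE unlift_none.
- rewrite !ffunE liftK (_ : widen_ord _ _ = ord0) ?unlift_none //.
  exact: val_inj.
apply: eq_bigr => k _; rewrite !ffunE liftK /=.
rewrite (_ : widen_ord _ _ = lift ord0 (widen_ord (leqnSn n) k)) ?liftK //.
exact: val_inj.
Qed.

Lemma elementary_weight_ladder (R : realType) s (A : 'M[R]_s) (w : 'rV_s) n :
  elementary_weight A w (ladder n.+1) =
  (w *m A ^+ n *m const_mx 1 : 'M_1) 0 0.
Proof.
rewrite -mx_pow_paths; apply: eq_bigr => i _; congr (_ * _).
  rewrite (big_pred1 ord0) // => k.
  by rewrite /is_root -has_depth0 has_depth_ladder eq_sym.
rewrite -(pair_big_dep xpredT (edge (ladder n.+1))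
  (fun v u => A (i u) (i v))) /= big_ord_recl /= big1 ?mul1r => [|u].
  apply: eq_bigr => k _; rewrite (big_pred1 (widen_ord (leqnSn n) k)) // => u.
  rewrite /edge (@ladder_edge _ _ (widen_ord (leqnSn n) k)) //.
by rewrite /edge ladder_root.
Qed.

(** * Inverse factorials satisfy no linear recurrence *)

Lemma poly_vanish_on_nat (R : numDomainType) (p : {poly R}) :
  (forall m : nat, p.[m%:R] = 0) -> p = 0.
Proof.
move=> p0; apply/eqP/negPn/negP => pn0.
have /= := max_poly_roots (rs := [seq m%:R | m <- iota 0 (size p)]) pn0.
rewrite size_map size_iota ltnn => H; suff: false by []; apply: H.
  by apply/allP => _ /mapP [m _ ->]; rewrite /root p0.
by rewrite map_inj_uniq ?iota_uniq // => i j /eqP; rewrite eqr_nat => /eqP.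
Qed.

(** Multiplication by (m + s).+1`! turns the inverse factorial of index k into
    a polynomial in m. *)
Lemma fact_shift (R : numFieldType) m k s : (k <= s)%N ->
  \prod_(k <= l < s) (m%:R + l.+2%:R) / (m + s).+1`!%:R
  = ((m + k).+1`!%:R)^-1 :> R.
Proof.
move=> /subnKC <-; elim: (s - k)%N => [|d IH].
  by rewrite addn0 big_geq // mul1r.
rewrite addnS big_nat_recr ?leq_addr //= -{}IH addnS factS -mulrA; congr (_ * _).
rewrite natrM -natrD !addnS invfM mulrA divff ?mul1r //.
by rewrite pnatr_eq0.
Qed.

(** After multiplication by (m + s).+1`! the recurrence says that the
    polynomial Q below vanishes at every natural number m, hence is zero.  At
    - (s + 1), all products but the empty one, of index s, contain the factor
    x + (s + 1), so the value of Q there is c s. *)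
Lemma inv_fact_not_recurrent (R : numFieldType) s (c : nat -> R) :
  (forall m, \sum_(k < s.+1) c k / (m + k).+1`!%:R = 0) -> c s = 0.
Proof.
move=> rec; pose Q : {poly R} :=
  \sum_(k < s.+1) c k *: \prod_(k <= l < s) ('X + l.+2%:R%:P).
have QE x : Q.[x] = \sum_(k < s.+1) c k * \prod_(k <= l < s) (x + l.+2%:R).
  rewrite horner_sum; apply: eq_bigr => k _; rewrite hornerZ horner_prod.
  by congr (_ * _); apply: eq_bigr => l _; rewrite !hornerE.
have Q0 : Q = 0.
  apply: poly_vanish_on_nat => m; apply/eqP.
  have f0 : ((m + s).+1`!%:R : R)^-1 != 0.
    by rewrite invr_eq0 pnatr_eq0 -lt0n fact_gt0.
  rewrite -(inj_eq (mulIf f0)) mul0r -(rec m) QE mulr_suml; apply/eqP.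
  apply: eq_bigr => k _; rewrite -mulrA; congr (_ * _).
  by rewrite fact_shift // -ltnS.
have := QE (- s.+1%:R); rewrite Q0 horner0 big_ord_recr /= big_geq // mulr1.
rewrite big1 ?add0r // => k _.
have s_gt0 : (0 < s)%N by apply: leq_ltn_trans (ltn_ord k).
(* The vanishing factor has index l = s - 1, as l.+2 = s.+1. *)
rewrite (bigD1_seq s.-1) ?iota_uniq //=; last first.
  by rewrite mem_index_iota -ltnS prednK // ltn_ord leqnn.
by rewrite prednK // addNr mul0r mulr0.
Qed.

(** This is Cayley-Hamilton, multiplied by w A^m on the left and by e on the
    right. *)
Lemma mx_pow_recurrence (F : comNzRingType) n (A : 'M[F]_n.+1) (w : 'rV_n.+1)
    (e : 'cV_n.+1) m :
  \sum_(k < n.+2) (char_poly A)`_k * (w *m A ^+ (m + k) *m e) 0 0 = 0.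
Proof.
have H : \sum_(k < n.+2) (char_poly A)`_k *: A ^+ k = 0.
  rewrite -[RHS](Cayley_Hamilton A) -[X in horner_mx A X]coefK poly_def.
  rewrite size_char_poly raddf_sum; apply: eq_bigr => k _.
  by rewrite /= linearZ rmorphXn /= horner_mx_X.
transitivity ((w *m A ^+ m *m
    (\sum_(k < n.+2) (char_poly A)`_k *: A ^+ k) *m e) 0 0); last first.
  by rewrite H mulmx0 mul0mx mxE.
rewrite mulmx_sumr mulmx_suml summxE.
apply: eq_bigr => k _.
by rewrite -scalemxAr -scalemxAl [RHS]mxE exprD -mulmxE !mulmxA.
Qed.

(** * Volume preservation is impossible *)

Theorem theorem4p17 (R : realType) (a b : coeff_map R)
    (a_consistent : consistent a) (a_RK : aromatic_RK a)
    (b_modified : modified_field a b) :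
  ~ volume_preserving b.
Proof.
move=> b_vp; case: a_RK => s [A [w [s_gt0 aE]]].
case: s s_gt0 A w aE => // s _ A w aE.
have aL n : ladder_coef (Bseries a n.+1 : tOmega R 1 n.+1) =
    (w *m A ^+ n *m const_mx 1 : 'M_1) 0 0.
  rewrite ladder_coef_Bseries.
  have [t Lt] := tforest_exists (card_ord _) (ladder_forest n) (ladder_no_loop _).
  rewrite (iso_tcls _ _ _ Lt) [LHS]aE; last exact: connected_ladder Lt.
  by rewrite -(elementary_weight_iso _ _ Lt) elementary_weight_ladder.
have bL M : ladder_coef (Bseries b M : tOmega R 1 M) = (M == 1%N)%:R.
  case: M => [|[|n]]; first by rewrite ladder_coef0.
    (* In degree 1 the exponential is the identity: b(L_1) = a(L_1). *)
    rewrite -[LHS]ladder_coef_exp1 -b_modified ladder_coef_Bseries.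
    by rewrite (iso_tcls _ _ _ ladder_bullet).
  have [c Lc] := tforest_exists (card_ord _) (cycle_graph_forest n)
    (cycle_graph_no_loop n).
  apply: dH_cycle_coef_eq0 Lc _.
  by rewrite -[dH _]/(dHs (Bseries b) n.+2) b_vp ffunE.
have aexp n : ladder_coef (Bseries a n.+1 : tOmega R 1 n.+1) = (n.+1`!%:R)^-1.
  by rewrite b_modified ladder_coef_exp.
have rec m :
    \sum_(k < s.+2) (char_poly A)`_k / (m + k).+1`!%:R = 0 :> R.
  rewrite -[RHS](mx_pow_recurrence A w (const_mx 1) m).
  by apply: eq_bigr => k _; rewrite -aL aexp.
have := inv_fact_not_recurrent (c := fun k => (char_poly A)`_k) rec.
have /monicP := char_poly_monic A; rewrite /lead_coef size_char_poly /= => ->.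
by move/eqP; rewrite oner_eq0.
Qed.
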